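(* Let $(E,C)$ be an adaptable separated graph and let $\mathcal E$ be the semilattice of idempotents of the inverse semigroup $S(E,C)$. The space $\widehat{\mathcal E}_{\infty}$ of ultrafilters on $\mathcal E$ is closed in the space $\widehat{\mathcal E}_0$ of filters on $\mathcal E$. Consequently, the space of ultrafilters coincides with the space of tight filters.
   Context: **Adaptable separated graphs.** $\mathbb N=\{1,2,\dots\}$. For a directed graph $E=(E^0,E^1,s,r)$, paths are $e_1\cdots e_n$ with $r(e_i)=s(e_{i+1})$; vertices are paths of length $0$. A separated graph $(E,C)$ is a directed graph $E$ with $C=\bigsqcup_{v\in E^0}C_v$, where $C_v$ is a partition of $s^{-1}(v)$ into nonempty subsets ($C_v=\emptyset$ if $v$ is a sink). It is finitely separated if all sets in $C$ are finite. Put $v\le w$ if there is a path from $w$ to $v$; let $(I,\le)$ be the antisymmetrization of $(E^0,\le)$, whose elements are the transitive components. A finitely separated graph $(E,C)$ is adaptable if $I$ is finite and there are a partition $I=I_{free}\sqcup I_{reg}$ and subgraphs $(E_p)_{p\in I}$, with $E_p^0$ the vertex set of the component $p$, such that: (1) $E^0=\bigsqcup_p E_p^0$; $E_p$ is a transitive (any two vertices joined by a directed path) row-finite graph if $p\in I_{reg}$; $E_p^0=\{v^p\}$ if $p\in I_{free}$. (2) For $p\in I_{reg}$, $w\in E_p^0$: $|C_w|=1$, $|s_{E_p}^{-1}(w)|\ge 2$, and every edge with source $w$ lies in $E_p$ or has range in $E_q^0$ with $q<p$. (3) For $p\in I_{free}$: $s^{-1}(v^p)=\emptyset$ iff $p$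 is minimal in $I$ (then put $k(p)=0$). If $p$ is not minimal, $C_{v^p}=\{X_1^{(p)},\dots,X_{k(p)}^{(p)}\}$ is finite with $X_i^{(p)}=\{\alpha(p,i),\beta(p,i,1),\dots,\beta(p,i,g(p,i))\}$, $g(p,i)\ge1$, $\alpha(p,i)$ a loop at $v^p$, $r(\beta(p,i,t))\in E_q^0$ with $q<p$; and $E_p^1=\{\alpha(p,1),\dots,\alpha(p,k(p))\}$. **The inverse semigroup $S(E,C)$.** It is the $*$-semigroup with $0$ ($*$-semigroup: $s^{**}=s$, $(st)^*=t^*s^*$) generated by $E^0\cup E^1\cup\{(t_i^v)^{\pm1}: i\in\mathbb N,v\in E^0\}$ with relations: (R1) $vw=\delta_{v,w}v$, $v^*=v$ for $v,w\in E^0$; (R2) $e=s(e)e=er(e)$ for $e\in E^1$, and $e^*f=\delta_{e,f}r(e)$ for $e,f$ in the same set $X\in C$; (R3) for $p\in I_{free}$, $i\ne j$: $\alpha(p,i)\alpha(p,j)=\alpha(p,j)\alpha(p,i)$, $\alpha(p,i)\alpha(p,j)^*=\alpha(p,j)^*\alpha(p,i)$; (R4) for $p\in I_{free}$: $\beta(p,i,s)^*\beta(p,j,t)=0$ if $(i,s)\neq(j,t)$; (R5) for each $v$ the elements $(t_i^v)^{\pm1}$ commute mutually, $vt_i^v=t_i^v=t_i^vv$, $t_i^v(t_i^v)^{-1}=v=(t_i^v)^{-1}t_i^v$, $(t_i^v)^*=(t_i^v)^{-1}$; (R6) $t_i^{s(e)}e=e\,t_i^{r(e)}$ if $s(e)\in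 E_p^0$, $p\in I_{reg}$; (R7) for $p\in I_{free}$: $(t_i^{v^p})^{\pm1}\beta(p,j,s)=\beta(p,j,s)(t^{r(\beta(p,j,s))}_{i+k(p)-1})^{\pm1}$; (R8) for $p\in I_{free}$, $i\ne j$: $\alpha(p,i)\beta(p,j,s)=\beta(p,j,s)t^{r(\beta(p,j,s))}_{\sigma_j^p(i)}$ and $\alpha(p,i)^*\beta(p,j,s)=\beta(p,j,s)(t^{r(\beta(p,j,s))}_{\sigma_j^p(i)})^{-1}$, where $\sigma_j^p$ is the increasing bijection $\{1,\dots,k(p)\}\setminus\{j\}\to\{1,\dots,k(p)-1\}$; (R9) for $p\in I_{free}$: $t_i^{v^p}$ commutes with $\alpha(p,j)$ and $\alpha(p,j)^*$. $S(E,C)$ is an inverse semigroup; $\mathcal E$ is its semilattice of idempotents ($e\le f$ iff $ef=e$). **Filters.** A filter on $\mathcal E$ is a nonempty $\eta\subseteq\mathcal E$ with $0\notin\eta$, closed under products and upward closed. $\widehat{\mathcal E}_0$ is the set of filters, with the topology having as basis the sets $\mathcal U(X,Y)=\{\eta: X\subseteq\eta,\ Y\cap\eta=\emptyset\}$, $X,Y\subseteq\mathcal E$ finite. An ultrafilter is a filter maximal under inclusion. A finite cover of $\mathcal F_e=\{f\in\mathcal E:f\le e\}$ is a finite $Z\subseteq\mathcal F_e$ such that every $0\ne f\in\mathcal F_e$ has $fz\neq0$ for some $z\in Z$. A filter $\eta$ is tight if $e\in\eta$ implies $Z\cap\eta\ne\emptyset$ for every $e\in\mathcal E$ and every finite cover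 $Z$ of $\mathcal F_e$. (By a theorem of Exel, the set of tight filters is the closure of the set of ultrafilters in $\widehat{\mathcal E}_0$.) *)

(* Defs.v *)
From HB Require Import structures.
From mathcomp Require Import all_boot.
From mathcomp Require Import all_classical topology.

Set Implicit Arguments.
Unset Strict Implicit.
Unset Printing Implicit Defensive.

Local Open Scope classical_set_scope.
Local Open Scope quotient_scope.

Record digraph := Digraph {
  vertex : Type;
  edge : Type;
  src : edge -> vertex;
  rng : edge -> vertex
}.

HB.instance Definition _ (G : digraph) := gen_eqMixin (vertex G).
HB.instance Definition _ (G : digraph) := gen_choiceMixin (vertex G).

(* [is_path D u es w]: the list [es] is a path from [u] to [w], all of whose
   edges lie in [D]; the empty list is the path of length 0 at [u]. *)
Fixpoint is_path (G : digraph) (D : set (edge G)) (u : vertex G)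
    (es : seq (edge G)) (w : vertex G) : Prop :=
  if es is e :: es' then [/\ D e, src e = u & is_path D (rng e) es' w]
  else u = w.

Definition joined (G : digraph) (D : set (edge G)) (u w : vertex G) : Prop :=
  exists es, is_path D u es w.

Definition vle (G : digraph) (v w : vertex G) : Prop := joined setT w v.

Lemma joined_trans (G : digraph) (D : set (edge G)) (u v w : vertex G) :
  joined D u v -> joined D v w -> joined D u w.
Proof.
move=> [es]; elim: es u => [|e es IH] u /=; first by move=> ->.
by move=> [De <- /IH h] /h [fs fsP]; exists (e :: fs).
Qed.

Definition scc (G : digraph) (v w : vertex G) : bool :=
  `[< vle v w /\ vle w v >].

Lemma scc_refl (G : digraph) : reflexive (@scc G).
Proof. by move=> v; apply/asboolP; split; exists [::]. Qed.

Lemma scc_sym (G : digraph) : symmetric (@scc G).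
Proof. by move=> v w; apply/asboolP/asboolP => -[? ?]; split. Qed.

Lemma scc_trans (G : digraph) : transitive (@scc G).
Proof.
move=> w v u /asboolP[vw wv] /asboolP[wu uw]; apply/asboolP.
by split; [exact: joined_trans wu vw|exact: joined_trans wv uw].
Qed.

Canonical scc_equiv (G : digraph) :=
  EquivRel (@scc G) (@scc_refl G) (@scc_sym G) (@scc_trans G).

(* The antisymmetrization of the preorder [vle]. *)
Definition component (G : digraph) := {eq_quot (@scc G)}.
HB.instance Definition _ (G : digraph) := Choice.on (component G).

Definition comp_vtx (G : digraph) (p : component G) : set (vertex G) :=
  [set v | \pi_(component G) v = p].

Definition comp_le (G : digraph) (p q : component G) : Prop :=
  exists v w, [/\ comp_vtx p v, comp_vtx q w & vle v w].

Definition comp_lt (G : digraph) (p q : component G) : Prop :=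
  comp_le p q /\ p <> q.

Definition comp_minimal (G : digraph) (p : component G) : Prop :=
  forall q : component G, ~ comp_lt q p.

Record sepgraph := SepGraph {
  sep_graph :> digraph;
  sep : vertex sep_graph -> set (set (edge sep_graph));
  sepP : forall v, partition (sep v) id [set e | src e = v]
}.

Definition finitely_separated (G : sepgraph) : Prop :=
  forall (v : vertex G) (X : set (edge G)), sep v X -> finite_set X.

(* The vertex of a component [p] with exactly one vertex. *)
Definition comp_pt (G : digraph) (p : component G) : vertex G := repr p.

(* An adaptable separated graph, together with the data exhibiting it as such.
   [free_comp] is the set of free components, its complement is the set of
   regular ones, and [sub_edge p] is the edge set of the subgraph E_p. The
   numbers k(p) and g(p,i) are [num_loops p] and [num_exits i]. Indices start
   at 0: for [i : 'I_(num_loops p)] and [t : 'I_(num_exits i)], [alpha i] is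
   alpha(p,i+1) and [beta t] is beta(p,i+1,t+1). These data are unconstrained,
   and never used, when [p] is regular. *)
Record adaptable (G : sepgraph) := Adaptable {
  adaptable_fin_sep : finitely_separated G;
  adaptable_fin_comp : finite_set [set: component G];
  free_comp : set (component G);
  sub_edge : component G -> set (edge G);
  num_loops : component G -> nat;
  num_exits : forall p : component G, 'I_(num_loops p) -> nat;
  alpha : forall p : component G, 'I_(num_loops p) -> edge G;
  beta : forall (p : component G) (i : 'I_(num_loops p)),
    'I_(num_exits i) -> edge G;

  sub_edgeP : forall p e, sub_edge p e ->
    comp_vtx p (src e) /\ comp_vtx p (rng e);

  reg_transitive : forall p, ~ free_comp p -> forall v w,
    comp_vtx p v -> comp_vtx p w -> joined (sub_edge p) v w;
  reg_row_finite : forall p, ~ free_comp p -> forall v,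
    comp_vtx p v -> finite_set [set e | sub_edge p e /\ src e = v];
  reg_sep : forall p, ~ free_comp p -> forall w,
    comp_vtx p w -> exists X, sep w = [set X];
  reg_two_edges : forall p, ~ free_comp p -> forall w, comp_vtx p w ->
    (`I_2 #<= [set e | sub_edge p e /\ src e = w])%card;
  reg_edge : forall p, ~ free_comp p -> forall e, comp_vtx p (src e) ->
    sub_edge p e \/ exists2 q, comp_lt q p & comp_vtx q (rng e);

  free_vtx : forall p, free_comp p -> comp_vtx p = [set comp_pt p];
  free_sink : forall p, free_comp p ->
    ([set e : edge G | src e = comp_pt p] = set0 <-> comp_minimal p);
  free_num_loops0 : forall p, free_comp p -> comp_minimal p -> num_loops p = 0;
  free_block_inj : forall p, free_comp p -> ~ comp_minimal p ->
    injective (fun i => alpha i |` range (@beta p i));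
  free_sep : forall p, free_comp p -> ~ comp_minimal p ->
    sep (comp_pt p) = range (fun i => alpha i |` range (@beta p i));
  free_num_exits_gt0 : forall p, free_comp p -> ~ comp_minimal p ->
    forall i : 'I_(num_loops p), 0 < num_exits i;
  free_beta_inj : forall p, free_comp p -> ~ comp_minimal p ->
    forall i : 'I_(num_loops p), injective (@beta p i);
  free_alpha_loop : forall p, free_comp p -> ~ comp_minimal p ->
    forall i : 'I_(num_loops p),
      src (alpha i) = comp_pt p /\ rng (alpha i) = comp_pt p;
  free_beta_rng : forall p, free_comp p -> ~ comp_minimal p ->
    forall (i : 'I_(num_loops p)) (s : 'I_(num_exits i)),
      exists2 q, comp_lt q p & comp_vtx q (rng (beta s));
  free_sub_edge : forall p, free_comp p -> ~ comp_minimal p ->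
    sub_edge p = range (@alpha p)
}.

HB.mixin Record isStarSemigroup0 S of Semigroup S := {
  szero : S;
  sstar : S -> S;
  szero_mul : forall x : S, (szero * x)%g = szero;
  smul_zero : forall x : S, (x * szero)%g = szero;
  sstarK : involutive sstar;
  sstarM : forall x y : S, sstar (x * y)%g = (sstar y * sstar x)%g
}.

#[short(type="starSemigroup0Type")]
HB.structure Definition StarSemigroup0 :=
  {S of isStarSemigroup0 S & Semigroup S}.

(* Terms in the generators. [GT i true v] and [GT i false v] stand for
   t_(i+1)^v and its formal inverse. *)
Inductive sterm (G : digraph) : Type :=
| GV of vertex G
| GE of edge G
| GT of nat & bool & vertex G
| TZero
| TMul of sterm G & sterm G
| TStar of sterm G.

Arguments TZero {G}.

HB.instance Definition _ (G : digraph) := gen_eqMixin (sterm G).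
HB.instance Definition _ (G : digraph) := gen_choiceMixin (sterm G).

Declare Scope sterm_scope.
Delimit Scope sterm_scope with sterm.
Bind Scope sterm_scope with sterm.
Notation "x * y" := (TMul x y) : sterm_scope.
Notation "x ^*" := (TStar x) : sterm_scope.
Notation "0" := TZero : sterm_scope.

(* The defining relations. As indices start at 0, the increasing bijection
   from {1, .., k(p)} minus j onto {1, .., k(p) - 1} becomes [unbump j]. *)
Inductive srel (G : sepgraph) (A : adaptable G) : sterm G -> sterm G -> Prop :=
| vtx_idem (v : vertex G) : srel A (GV v * GV v) (GV v)
| vtx_orth (v w : vertex G) : v <> w -> srel A (GV v * GV w) 0
| vtx_star (v : vertex G) : srel A ((GV v)^*) (GV v)
| edge_src (e : edge G) : srel A (GE e) (GV (src e) * GE e)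
| edge_rng (e : edge G) : srel A (GE e) (GE e * GV (rng e))
| edge_star_edge (e : edge G) : srel A ((GE e)^* * GE e) (GV (rng e))
| edge_orth (v : vertex G) (X : set (edge G)) (e f : edge G) :
    sep v X -> X e -> X f -> e <> f -> srel A ((GE e)^* * GE f) 0
| alpha_alpha (p : component G) (i j : 'I_(num_loops A p)) :
    free_comp A p -> i <> j ->
    srel A (GE (alpha i) * GE (alpha j)) (GE (alpha j) * GE (alpha i))
| alpha_alpha_star (p : component G) (i j : 'I_(num_loops A p)) :
    free_comp A p -> i <> j ->
    srel A (GE (alpha i) * (GE (alpha j))^*) ((GE (alpha j))^* * GE (alpha i))
| beta_orth (p : component G)
    (x y : {i : 'I_(num_loops A p) & 'I_(num_exits i)}) :
    free_comp A p -> x <> y ->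
    srel A ((GE (beta (tagged x)))^* * GE (beta (tagged y))) 0
| t_comm (v : vertex G) (i j : nat) (a b : bool) :
    srel A (GT i a v * GT j b v) (GT j b v * GT i a v)
| vtx_t (v : vertex G) (i : nat) : srel A (GV v * GT i true v) (GT i true v)
| t_vtx (v : vertex G) (i : nat) : srel A (GT i true v * GV v) (GT i true v)
| t_tinv (v : vertex G) (i : nat) :
    srel A (GT i true v * GT i false v) (GV v)
| tinv_t (v : vertex G) (i : nat) :
    srel A (GT i false v * GT i true v) (GV v)
| t_star (v : vertex G) (i : nat) : srel A ((GT i true v)^*) (GT i false v)
| t_reg (e : edge G) (i : nat) :
    ~ free_comp A (\pi_(component G) (src e)) ->
    srel A (GT i true (src e) * GE e) (GE e * GT i true (rng e))
| t_beta (p : component G) (j : 'I_(num_loops A p)) (s : 'I_(num_exits j))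
    (i : nat) (a : bool) :
    free_comp A p ->
    srel A (GT i a (comp_pt p) * GE (beta s))
           (GE (beta s) * GT (i + num_loops A p - 1) a (rng (beta s)))
| alpha_beta (p : component G)
    (i j : 'I_(num_loops A p)) (s : 'I_(num_exits j)) :
    free_comp A p -> i <> j ->
    srel A (GE (alpha i) * GE (beta s))
           (GE (beta s) * GT (unbump j i) true (rng (beta s)))
| alpha_star_beta (p : component G)
    (i j : 'I_(num_loops A p)) (s : 'I_(num_exits j)) :
    free_comp A p -> i <> j ->
    srel A ((GE (alpha i))^* * GE (beta s))
           (GE (beta s) * GT (unbump j i) false (rng (beta s)))
| t_alpha (p : component G) (j : 'I_(num_loops A p)) (i : nat) :
    free_comp A p ->
    srel A (GT i true (comp_pt p) * GE (alpha j))
           (GE (alpha j) * GT i true (comp_pt p))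
| t_alpha_star (p : component G) (j : 'I_(num_loops A p)) (i : nat) :
    free_comp A p ->
    srel A (GT i true (comp_pt p) * (GE (alpha j))^*)
           ((GE (alpha j))^* * GT i true (comp_pt p)).

(* The smallest congruence that contains the defining relations and whose
   quotient is a *-semigroup with zero. *)
Inductive scong (G : sepgraph) (A : adaptable G) : sterm G -> sterm G -> Prop :=
| scong_rel x y : srel A x y -> scong A x y
| scong_refl x : scong A x x
| scong_sym x y : scong A x y -> scong A y x
| scong_trans y x z : scong A x y -> scong A y z -> scong A x z
| scong_mul x x' y y' :
    scong A x x' -> scong A y y' -> scong A (x * y) (x' * y')
| scong_star x x' : scong A x x' -> scong A (x^*) (x'^*)
| scong_mulA x y z : scong A (x * (y * z)) (x * y * z)
| scong_0mul x : scong A (0 * x) 0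
| scong_mul0 x : scong A (x * 0) 0
| scong_starK x : scong A (x^*^*) x
| scong_starM x y : scong A ((x * y)^*) (y^* * x^*).

Definition scongb (G : sepgraph) (A : adaptable G) (x y : sterm G) : bool :=
  `[< scong A x y >].

Lemma scongb_refl (G : sepgraph) (A : adaptable G) : reflexive (scongb A).
Proof. by move=> x; apply/asboolP; exact: scong_refl. Qed.

Lemma scongb_sym (G : sepgraph) (A : adaptable G) : symmetric (scongb A).
Proof. by move=> x y; apply/asboolP/asboolP => /scong_sym. Qed.

Lemma scongb_trans (G : sepgraph) (A : adaptable G) : transitive (scongb A).
Proof.
move=> y x z /asboolP xy /asboolP yz; apply/asboolP.
exact: scong_trans xy yz.
Qed.

Canonical scongb_equiv (G : sepgraph) (A : adaptable G) :=
  EquivRel (scongb A) (@scongb_refl G A) (@scongb_sym G A) (@scongb_trans G A).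

(* The semigroup S(E,C). *)
Definition SEC (G : sepgraph) (A : adaptable G) := {eq_quot (scongb A)}.
HB.instance Definition _ (G : sepgraph) (A : adaptable G) :=
  Choice.on (SEC A).

Section SECStructure.
Context (G : sepgraph) (A : adaptable G).
Implicit Types x y z : SEC A.

Definition sec_pi (t : sterm G) : SEC A := \pi_(SEC A) t.

Definition sec_mul x y : SEC A := sec_pi (TMul (repr x) (repr y)).
Definition sec_star x : SEC A := sec_pi (TStar (repr x)).
Definition sec_zero : SEC A := sec_pi TZero.

Lemma sec_piP (s t : sterm G) : sec_pi s = sec_pi t <-> scong A s t.
Proof.
split=> [/eqP|st].
  by rewrite /sec_pi eqmodE => /asboolP.
by apply/eqP; rewrite /sec_pi eqmodE; apply/asboolP.
Qed.

Lemma sec_reprK x : sec_pi (repr x) = x.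
Proof. exact: reprK. Qed.

Lemma repr_sec_pi (t : sterm G) : scong A (repr (sec_pi t)) t.
Proof. by apply/sec_piP; rewrite sec_reprK. Qed.

Lemma sec_pi_mul (s t : sterm G) :
  sec_mul (sec_pi s) (sec_pi t) = sec_pi (TMul s t).
Proof. by apply/sec_piP; apply: scong_mul; exact: repr_sec_pi. Qed.

Lemma sec_pi_star (t : sterm G) : sec_star (sec_pi t) = sec_pi (TStar t).
Proof. by apply/sec_piP; apply: scong_star; exact: repr_sec_pi. Qed.

Lemma sec_mulA : associative sec_mul.
Proof.
move=> x y z; rewrite -(sec_reprK x) -(sec_reprK y) -(sec_reprK z).
by rewrite !sec_pi_mul; apply/sec_piP; exact: scong_mulA.
Qed.

HB.instance Definition _ := hasMul.Build (SEC A) sec_mul.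
HB.instance Definition _ := Magma_isSemigroup.Build (SEC A) sec_mulA.

Lemma sec_0mul x : (sec_zero * x)%g = sec_zero.
Proof.
rewrite -(sec_reprK x); apply: etrans (sec_pi_mul _ _) _.
by apply/sec_piP; exact: scong_0mul.
Qed.

Lemma sec_mul0 x : (x * sec_zero)%g = sec_zero.
Proof.
rewrite -(sec_reprK x); apply: etrans (sec_pi_mul _ _) _.
by apply/sec_piP; exact: scong_mul0.
Qed.

Lemma sec_starK : involutive sec_star.
Proof.
move=> x; rewrite -(sec_reprK x) !sec_pi_star.
by apply/sec_piP; exact: scong_starK.
Qed.

Lemma sec_starM x y : sec_star (x * y)%g = (sec_star y * sec_star x)%g.
Proof.
suff h (s t : sterm G) : sec_star (sec_mul (sec_pi s) (sec_pi t)) =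
    sec_mul (sec_star (sec_pi t)) (sec_star (sec_pi s)).
  by have := h (repr x) (repr y); rewrite !sec_reprK.
rewrite sec_pi_mul !sec_pi_star sec_pi_mul.
by apply/sec_piP; exact: scong_starM.
Qed.

HB.instance Definition _ :=
  isStarSemigroup0.Build (SEC A) sec_0mul sec_mul0 sec_starK sec_starM.

End SECStructure.

Definition idempotents (S : starSemigroup0Type) : set S :=
  [set e | (e * e)%g = e].

Definition ile (S : starSemigroup0Type) (e f : S) : Prop := (e * f)%g = e.

Record is_sfilter (S : starSemigroup0Type) (eta : set S) : Prop := IsSFilter {
  sfilter_idem : eta `<=` @idempotents S;
  sfilter_neq0 : eta !=set0;
  sfilter_no0 : ~ eta szero;
  sfilter_mul : forall e f, eta e -> eta f -> eta (e * f)%g;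
  sfilter_up : forall e f, eta e -> idempotents f -> ile e f -> eta f
}.

(* The filters on the idempotents of [S]; named so as to avoid any confusion
   with the filters of sets of the library. *)
Record sfilter (S : starSemigroup0Type) := SFilter {
  sfilter_set :> set S;
  sfilterP : is_sfilter sfilter_set
}.

HB.instance Definition _ (S : starSemigroup0Type) := gen_eqMixin (sfilter S).
HB.instance Definition _ (S : starSemigroup0Type) :=
  gen_choiceMixin (sfilter S).

Section SFilterTopology.
Context (S : starSemigroup0Type).

Definition sfilter_index : set (set S * set S) :=
  [set XY | [/\ finite_set XY.1, finite_set XY.2,
    XY.1 `<=` @idempotents S & XY.2 `<=` @idempotents S]].

Definition sfilter_basic (XY : set S * set S) : set (sfilter S) :=
  [set eta : sfilter S | XY.1 `<=` eta /\ XY.2 `&` eta = set0].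

Lemma sfilter_basic_cover :
  \bigcup_(XY in sfilter_index) sfilter_basic XY = setT.
Proof.
apply/seteqP; split=> // eta _; exists (set0, set0).
  by split; [exact: finite_set0|exact: finite_set0| |].
by split; rewrite //= set0I.
Qed.

Lemma sfilter_basic_join i j eta : sfilter_index i -> sfilter_index j ->
  sfilter_basic i eta -> sfilter_basic j eta ->
  exists l, [/\ sfilter_index l, sfilter_basic l eta &
                sfilter_basic l `<=` sfilter_basic i `&` sfilter_basic j].
Proof.
move=> [i1 i2 i3 i4] [j1 j2 j3 j4] [bi1 bi2] [bj1 bj2].
exists (i.1 `|` j.1, i.2 `|` j.2); split.
- by split=> /=; rewrite ?finite_setU ?subUset.
- by split=> /=; [rewrite subUset|rewrite setIUl bi2 bj2 setU0].
- move=> xi [/= + +]; rewrite subUset setIUl => -[? ?].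
  by rewrite -subset0 subUset !subset0 => -[? ?]; split; split.
Qed.

HB.instance Definition _ := isBaseTopological.Build (sfilter S)
  sfilter_basic_cover sfilter_basic_join.

Definition ultrafilters : set (sfilter S) :=
  [set eta : sfilter S | forall xi : sfilter S, eta `<=` xi -> xi = eta].

Definition below (e : S) : set S := [set f | idempotents f /\ ile f e].

Definition finite_cover (e : S) (Z : set S) : Prop :=
  [/\ finite_set Z, Z `<=` below e &
    forall f, below e f -> f <> szero ->
      exists2 z, Z z & (f * z)%g <> szero].

Definition tight_filters : set (sfilter S) :=
  [set eta : sfilter S | forall (e : S) (Z : set S), idempotents e ->
    finite_cover e Z -> sfilter_set eta e -> Z `&` eta !=set0].

End SFilterTopology.

Arguments ultrafilters : clear implicits.
Arguments tight_filters : clear implicits.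

(* Main.v *)
(* The set P = {0} U {g g^* : g a path} is closed under conjugation by every
   generator and its adjoint, and any two elements
   of P commute. Hence every element s satisfies s s^* s = s, and the
   idempotents of S(E,C) are exactly the elements of P.

   For a vertex v, a path g from v and a block X of C_v, an idempotent below v
   that is orthogonal to all y y^* with y in X vanishes. Applied along g, this
   gives finitely many idempotents below v, orthogonal to g g^*, which together
   with g g^* cover v. If a tight filter contains v and is contained in a filter
   containing g g^*, it must then contain g g^* itself: it is an ultrafilter.
   In any semilattice with 0, conversely, ultrafilters are tight and the tight
   filters form a closed set.

   No element of S(E,C) ever has to be shown nonzero, so no faithful model of
   the semigroup is needed. *)
Require Import Defs.
From mathcomp Require Import all_boot.
From mathcomp Require Import all_classical topology.

Set Implicit Arguments.
Unset Strict Implicit.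
Unset Printing Implicit Defensive.

(** * Filters on a semilattice with zero: ultrafilters are tight, and tight filters form a closed
    set *)

Section Filters.
Context (S : starSemigroup0Type).
Local Open Scope classical_set_scope.
Local Open Scope group_scope.

Lemma open_sfilter_basic (XY : set S * set S) :
  sfilter_index XY -> open (sfilter_basic XY).
Proof.
move=> iXY; exists [set XY]; first by move=> _ ->.
by rewrite bigcup_set1.
Qed.

Lemma finite_cover_idem (e : S) (Z : set S) :
  finite_cover e Z -> Z `<=` @idempotents S.
Proof. by case=> _ sZ _ z /sZ[]. Qed.

(** If [eta] contains [e] but misses a finite cover [Z] of [e], the basic open set of filters that
    contain [e] and miss [Z] is a neighbourhood of [eta] without tight filters. *)
Lemma closed_tight_filters : closed (tight_filters S).
Proof.
move=> eta cl_eta e Z ie Zcov eta_e; apply/set0P/negP => /eqP Zeta0.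
have iXY : sfilter_index ([set e], Z).
  case: (Zcov) => finZ _ _; split=> //=; first by move=> _ ->.
  exact: finite_cover_idem Zcov.
have nb : nbhs eta (sfilter_basic ([set e], Z)).
  apply: open_nbhs_nbhs; split; first exact: open_sfilter_basic.
  by split=> //= _ ->.
have [xi [xi_tight [/= xi_e Zxi0]]] := cl_eta _ nb.
have := xi_tight e Z ie Zcov (xi_e e erefl).
by rewrite Zxi0 => -[].
Qed.

Hypothesis idemC : forall e f : S, idempotents e -> idempotents f ->
  e * f = f * e.

Lemma idemM (e f : S) : idempotents e -> idempotents f -> idempotents (e * f).
Proof.
move=> ie idf; have fe := idemC ie idf; rewrite /idempotents /=.
by rewrite mulgA -(mulgA e f e) -fe mulgA ie -mulgA idf.
Qed.

(** The idempotents above some [f * z] with [f] in [eta] form a filter [F] that contains both [eta]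
    and [z]; by maximality [F] is [eta]. *)
Lemma ultrafilter_meet (eta : sfilter S) (z : S) : ultrafilters S eta ->
  idempotents z -> (forall f, sfilter_set eta f -> f * z <> szero) ->
  sfilter_set eta z.
Proof.
move=> eta_ultra iz nz; pose F : set S :=
  [set g | idempotents g /\ exists2 f, sfilter_set eta f & f * z * g = f * z].
have etaI f : sfilter_set eta f -> idempotents f.
  exact: sfilter_idem (sfilterP eta) f.
have FP : is_sfilter F.
  split.
  - by move=> g [].
  - have [f eta_f] := sfilter_neq0 (sfilterP eta).
    by exists z; split=> //; exists f; rewrite // -mulgA iz.
  - by move=> [_ [f eta_f]]; rewrite smul_zero => /esym; exact: nz.
  - move=> g h [ig [f ef fg]] [ih [k ek kh]]; split; first exact: idemM.
    exists (f * k); first exact: sfilter_mul (sfilterP eta) _ _ ef ek.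
    have kz := idemC (etaI _ ek) iz.
    have fkzE : f * k * z = f * z * (k * z).
      by rewrite -[LHS]mulgA kz [in RHS]mulgA -(mulgA f z z) iz mulgA.
    have kzg : k * z * g = g * (k * z).
      by apply: idemC => //; exact: idemM (etaI _ ek) iz.
    rewrite fkzE -[in RHS]fg -[in RHS]kh -!mulgA; do 2!congr (_ * _).
    by rewrite !mulgA kzg !mulgA.
  - move=> g h [ig [f ef fg]] ih gh; split=> //; exists f => //.
    by rewrite -fg -mulgA gh.
have /eta_ultra/(congr1 (@sfilter_set S)) <- : eta `<=` SFilter FP.
  move=> f eta_f; split; first exact: etaI.
  exists f => //; rewrite -mulgA -(idemC _ iz); last exact: etaI.
  by rewrite mulgA (etaI _ eta_f).
have [f eta_f] := sfilter_neq0 (sfilterP eta).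
by split=> //; exists f; rewrite // -mulgA iz.
Qed.

(** The product of [e] with one annihilator from [eta] for each of the finitely many elements of [Z]
    stays in [eta] and kills all of [Z] at once. *)
Lemma sfilter_avoid (eta : sfilter S) (e : S) (Z : set S) :
  finite_set Z -> sfilter_set eta e ->
  (forall z, Z z -> exists2 f, sfilter_set eta f & f * z = szero) ->
  exists f, [/\ sfilter_set eta f, f * e = f
              & forall z, Z z -> f * z = szero].
Proof.
have etaI f : sfilter_set eta f -> idempotents f.
  exact: sfilter_idem (sfilterP eta) f.
move=> /finite_seqP[s ->] eta_e; elim: s => [|z s IH] Zf.
  by exists e; split=> //; exact: etaI.
have [|f [ef fe fs]] := IH.
  by move=> y ys; apply: Zf; rewrite /= inE [y \in s]ys orbT.
have [|k ek kz] := Zf z; first by rewrite /= inE eqxx.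
exists (k * f); split; first exact: sfilter_mul (sfilterP eta) _ _ ek ef.
  by rewrite -mulgA fe.
move=> y; rewrite /= inE => /orP[/eqP ->|/fs fy].
  by rewrite (idemC (etaI _ ek) (etaI _ ef)) -mulgA kz smul_zero.
by rewrite -mulgA fy smul_zero.
Qed.

Lemma ultrafilter_tight : ultrafilters S `<=` tight_filters S.
Proof.
move=> eta eta_ultra e Z ie Zcov eta_e; apply: contrapT => Zeta.
have [finZ _ cov] := Zcov.
have Zf z : Z z -> exists2 f, sfilter_set eta f & f * z = szero.
  move=> Zz; apply: contrapT => nz; apply: Zeta; exists z; split=> //.
  apply: ultrafilter_meet => //; first exact: finite_cover_idem Zcov _ Zz.
  by move=> f eta_f fz; apply: nz; exists f.
have [f [eta_f fe fZ]] := sfilter_avoid finZ eta_e Zf.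
have [||z Zz] := cov f.
- by split=> //; exact: sfilter_idem (sfilterP eta) f eta_f.
- by move=> f0; apply: (sfilter_no0 (sfilterP eta)); rewrite -f0.
- by rewrite fZ.
Qed.

End Filters.

(** * The generators of S(E,C), and how edges with a common source interact *)

Section Generators.
Context (G : sepgraph) (A : adaptable G).
Local Open Scope classical_set_scope.
Local Open Scope group_scope.
Local Open Scope quotient_scope.

Local Notation "x ^*" := (sstar x) : group_scope.
Local Notation "0" := (szero : SEC A) : group_scope.
Local Notation free e := (free_comp A (\pi_(component G) (src e))).

Definition secV (v : vertex G) : SEC A := sec_pi A (GV v).
Definition secE (e : edge G) : SEC A := sec_pi A (GE e).
Definition secT (i : nat) (b : bool) (v : vertex G) : SEC A :=
  sec_pi A (GT i b v).

Local Notation V := secV.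
Local Notation E := secE.
Local Notation T := secT.

Lemma sec_piM s t : sec_pi A (TMul s t) = sec_pi A s * sec_pi A t.
Proof. exact/esym/sec_pi_mul. Qed.

Lemma sec_piS s : sec_pi A (TStar s) = (sec_pi A s)^*.
Proof. exact/esym/sec_pi_star. Qed.

Lemma sec_rel s t : srel A s t -> sec_pi A s = sec_pi A t.
Proof. by move=> st; apply/sec_piP; exact: scong_rel. Qed.

Lemma sstar0 : 0^* = 0.
Proof.
have h x : 0^* * x = 0^* by rewrite -[x]sstarK -sstarM smul_zero.
by rewrite -(h 0) smul_zero.
Qed.

Lemma mulgE21 (a b c x : SEC A) : a * b = c -> x * a * b = x * c.
Proof. by move=> <-; rewrite mulgA. Qed.

Lemma mulgE22 (a b c d x : SEC A) : a * b = c * d -> x * a * b = x * c * d.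
Proof. by rewrite -!mulgA => ->. Qed.

Lemma VV v : V v * V v = V v.
Proof. by rewrite -sec_piM; exact/sec_rel/vtx_idem. Qed.

Lemma VV0 v w : v <> w -> V v * V w = 0.
Proof. by move=> vw; rewrite -sec_piM; exact/sec_rel/vtx_orth. Qed.

Lemma Vstar v : (V v)^* = V v.
Proof. by rewrite -sec_piS; exact/sec_rel/vtx_star. Qed.

Lemma VE e : V (src e) * E e = E e.
Proof. by rewrite -sec_piM; exact/esym/sec_rel/edge_src. Qed.

Lemma EV e : E e * V (rng e) = E e.
Proof. by rewrite -sec_piM; exact/esym/sec_rel/edge_rng. Qed.

Lemma EsE e : (E e)^* * E e = V (rng e).
Proof. by rewrite -sec_piS -sec_piM; exact/sec_rel/edge_star_edge. Qed.

Lemma VEs e : V (rng e) * (E e)^* = (E e)^*.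
Proof. by rewrite -[V _]Vstar -sstarM EV. Qed.

Lemma EsV e : (E e)^* * V (src e) = (E e)^*.
Proof. by rewrite -[V _]Vstar -sstarM VE. Qed.

Lemma EEsE e : E e * (E e)^* * E e = E e.
Proof. by rewrite -mulgA EsE EV. Qed.

Lemma Tstar i b v : (T i b v)^* = T i (~~ b) v.
Proof.
have h : (T i true v)^* = T i false v.
  by rewrite -sec_piS; exact/sec_rel/t_star.
by case: b; rewrite //= -h sstarK.
Qed.

Lemma VT i b v : V v * T i b v = T i b v.
Proof.
have h : V v * T i true v = T i true v.
  by rewrite -sec_piM; exact/sec_rel/vtx_t.
have h' : T i true v * V v = T i true v.
  by rewrite -sec_piM; exact/sec_rel/t_vtx.
by case: b => //; rewrite -[T i false v](Tstar i true) -[V v]Vstar -sstarM h'.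
Qed.

Lemma TV i b v : T i b v * V v = T i b v.
Proof. by rewrite -[b]negbK -Tstar -[V v]Vstar -sstarM VT. Qed.

Lemma TTN i b v : T i b v * T i (~~ b) v = V v.
Proof.
by case: b; rewrite -sec_piM; apply: sec_rel; [exact: t_tinv|exact: tinv_t].
Qed.

Lemma NTT i b v : T i (~~ b) v * T i b v = V v.
Proof. by rewrite -[X in _ * T i X v]negbK TTN. Qed.

(** Several defining relations concern only the positive generators; multiplying by the inverses on
    both sides gives the same rule for the negative ones. *)
Lemma TE_both i v w j (x : SEC A) : V v * x = x -> x * V w = x ->
  T i true v * x = x * T j true w -> forall b, T i b v * x = x * T j b w.
Proof.
move=> vx xw tx [] //.
have : T i false v * (T i true v * x) * T j false w =
       T i false v * (x * T j true w) * T j false w by rewrite tx.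
rewrite -(mulgA _ (x * _)) -(mulgA x) (TTN j true) xw mulgA (NTT i true) vx.
by move=> <-.
Qed.

(** The axioms on blocks at a free vertex assume a non-minimal component. A vertex that emits an
    edge is not a sink, so its component qualifies. *)
Lemma src_free (e : edge G) : free e ->
  src e = comp_pt (\pi_(component G) (src e)) /\
  ~ comp_minimal (\pi_(component G) (src e)).
Proof.
move=> fe; set p := \pi_(component G) (src e).
have se : src e = comp_pt p.
  by have /seteqP[/(_ (src e)) + _] := free_vtx fe; apply.
split=> // /(free_sink fe) s0.
by have : [set e0 : edge G | src e0 = comp_pt p] e by []; rewrite s0.
Qed.

Lemma sep_edge (e : edge G) : exists2 X, sep (src e) X & X e.
Proof.
have [cov _ _] := sepP (src e).
have : cover (sep (src e)) id e by rewrite cov.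
by move=> [X sX Xe]; exists X.
Qed.

Lemma sep_src (v : vertex G) X e : sep v X -> X e -> src e = v.
Proof.
move=> vX Xe; have [cov _ _] := sepP v.
have : cover (sep v) id e by exists X.
by rewrite cov.
Qed.

Lemma EsE0 (v : vertex G) X e f : sep v X -> X e -> X f -> e <> f ->
  (E e)^* * E f = 0.
Proof.
move=> vX Xe Xf ef; rewrite -sec_piS -sec_piM; apply: sec_rel.
exact: edge_orth vX Xe Xf ef.
Qed.

Lemma T_edge i e : exists j, forall b,
  T i b (src e) * E e = E e * T j b (rng e).
Proof.
have [fe|ne] := pselect (free e); last first.
  exists i; apply: TE_both; rewrite ?VE ?EV // -!sec_piM.
  exact/sec_rel/t_reg.
have [se nmin] := src_free fe.
set p := \pi_(component G) (src e) in fe se nmin *.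
have [X] := sep_edge e.
rewrite se (free_sep fe nmin) => -[k _ <-] [->|[s _ <-]].
  have [_ ra] := free_alpha_loop fe nmin k.
  exists i; rewrite ra; apply: TE_both.
  - by have := VE (alpha k); rewrite (free_alpha_loop fe nmin k).1.
  - by have := EV (alpha k); rewrite ra.
  - by rewrite -!sec_piM; exact/sec_rel/t_alpha.
(* Exits shift the index by k(p) - 1. The index [k] of the block witnesses k(p) > 0, so the
   subtraction is not truncated. *)
exists (i + num_loops A p - 1)%N => b.
by rewrite -!sec_piM; exact/sec_rel/t_beta.
Qed.

(* [EdgeLoopExit] and [EdgeExitLoop]: a loop alpha moves past an exit beta of
   another block at the cost of a unitary [T] at the range of beta. *)
Inductive edge_rel (e f : edge G) : Prop :=
| EdgeEq of e = f
| EdgeOrth of (E e)^* * E f = 0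
| EdgeLoops of rng e = src e & rng f = src f & E e * E f = E f * E e
    & (E e)^* * E f = E f * (E e)^*
| EdgeLoopExit i of rng e = src e & E e * E f = E f * T i true (rng f)
    & (E e)^* * E f = E f * T i false (rng f)
| EdgeExitLoop i of rng f = src f & E f * E e = E e * T i true (rng e)
    & (E f)^* * E e = E e * T i false (rng e).

(** Distinct edges of one block are orthogonal, which settles regular vertices, as they carry a
    single block. Between two blocks of a free vertex, each edge is a loop or an exit, and each of
    the four combinations has its own relation. *)
Lemma edge_relP e f : src e = src f -> edge_rel e f.
Proof.
move=> sef; have [->|ef] := pselect (e = f); first exact: EdgeEq.
have [X sX Xe] := sep_edge e; have [Y sY Yf] := sep_edge f.
have orthXY : X = Y -> edge_rel e f.
  by move=> XY; apply: EdgeOrth; apply: EsE0 sX Xe _ ef; rewrite XY.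
have [fe|ne] := pselect (free e); last first.
  have [Z sZ] := reg_sep ne (erefl : comp_vtx _ (src e)).
  move: sX sY; rewrite -sef sZ => /= XZ YZ; apply: orthXY.
  by rewrite XZ YZ.
have [se nmin] := src_free fe.
set p := \pi_(component G) (src e) in fe se nmin *.
have loopP := free_alpha_loop fe nmin.
move: sX sY; rewrite -sef se (free_sep fe nmin) => -[i _ iX] [j _ jY].
have [ij|/eqP ij] := eqVneq i j; first by apply: orthXY; rewrite -iX -jY ij.
have ji : j <> i by move=> ji; apply: ij.
move: Xe Yf; rewrite -iX -jY => -[->|[s _ <-]] [->|[t _ <-]].
- apply: EdgeLoops; rewrite ?(loopP _).1 ?(loopP _).2 // -?sec_piS -!sec_piM.
    exact/sec_rel/alpha_alpha.
  exact/esym/sec_rel/alpha_alpha_star.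
- apply: (@EdgeLoopExit _ _ (unbump j i)).
  + by rewrite (loopP _).1 (loopP _).2.
  + by rewrite -!sec_piM; exact/sec_rel/alpha_beta.
  + by rewrite -sec_piS -!sec_piM; exact/sec_rel/alpha_star_beta.
- apply: (@EdgeExitLoop _ _ (unbump i j)).
  + by rewrite (loopP _).1 (loopP _).2.
  + by rewrite -!sec_piM; exact/sec_rel/alpha_beta.
  + by rewrite -sec_piS -!sec_piM; exact/sec_rel/alpha_star_beta.
- apply: EdgeOrth; rewrite -sec_piS -!sec_piM; apply: sec_rel.
  pose x := Tagged (fun k : 'I_(num_loops A p) => 'I_(num_exits k)) s.
  pose y := Tagged (fun k : 'I_(num_loops A p) => 'I_(num_exits k)) t.
  by apply: (@beta_orth _ A p x y) => // /(congr1 (@tag _ _)).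
Qed.

(** Here [f] is a loop and [e] an exit of another block. Both [f] and its adjoint turn into mutually
    inverse unitaries when moved past [e]; these cancel, so the range projection of [f] dominates
    that of [e]. *)
Lemma exit_proj_loop i e f : (E f) * E e = E e * T i true (rng e) ->
  (E f)^* * E e = E e * T i false (rng e) ->
  E e * (E e)^* * E f = E f * E e * (E e)^* /\
  E f * (E f)^* * E e = E e.
Proof.
move=> fe fse; have esf : (E e)^* * E f = T i true (rng e) * (E e)^*.
  by rewrite -[E f]sstarK -sstarM fse sstarM Tstar.
split; first by rewrite -mulgA esf mulgA -fe.
by rewrite -mulgA fse mulgA fe -mulgA (TTN i true) EV.
Qed.

(** At a free vertex the loop of the block serves. At a regular vertex the only block contains all
    outgoing edges, among them one inside the component, from whose range transitivity leads
    back. *)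
Lemma sep_joined (v : vertex G) X : sep v X ->
  exists2 y, X y & joined setT (rng y) v.
Proof.
move=> vX; have [_ _ /(_ X vX) [e Xe]] := sepP v.
have sev := sep_src vX Xe.
have [fe|ne] := pselect (free e).
  have [se nmin] := src_free fe.
  set p := \pi_(component G) (src e) in fe se nmin *.
  move: vX; rewrite -sev se (free_sep fe nmin) => -[i _ iX].
  exists (alpha i); first by rewrite -iX; left.
  by exists [::] => /=; exact: (free_alpha_loop fe nmin i).2.
set p := \pi_(component G) (src e) in ne.
have pv : comp_vtx p v by rewrite -sev.
have [f [pf sf]] : [set f | sub_edge A p f /\ src f = v] !=set0.
  apply/set0P/negP => /eqP f0; have := reg_two_edges ne pv; rewrite f0.
  rewrite card_le0 => /eqP I0.
  by have : `I_2 0%N by []; rewrite I0.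
have Xf : X f.
  have [Z sZ] := reg_sep ne pv; have [Y] := sep_edge f.
  by rewrite sf; move: vX; rewrite sZ => /= -> ->.
have [_ prf] := sub_edgeP pf.
exists f => //; have [es] := reg_transitive ne prf pv.
move=> esP; exists es; elim: es (rng f) esP {prf} => //= g es IH u [_ <- /IH].
by [].
Qed.

(* Outside [X], the second case is that of an exit [f], with [y] the loop of
   [X], and the third case that of a loop [f]. *)
Lemma sep_edge_cases (v : vertex G) X f : sep v X -> src f = v ->
  [\/ X f, exists2 y, X y & E y * (E y)^* * E f = E f |
      rng f = v /\ forall y, X y ->
        E y * (E y)^* * E f = E f * E y * (E y)^*].
Proof.
move=> vX sf; have [Xf|nXf] := pselect (X f); first by constructor 1.
have [ff|nf] := pselect (free f); last first.
  have pv : comp_vtx (\pi_(component G) (src f)) v by rewrite sf.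
  have [Z sZ] := reg_sep nf pv; have [Y] := sep_edge f.
  by rewrite sf; move: vX; rewrite sZ => /= -> -> Zf; constructor 1.
have [se nmin] := src_free ff.
set p := \pi_(component G) (src f) in ff se nmin *.
have loopP := free_alpha_loop ff nmin.
have [Y] := sep_edge f; move: vX; rewrite -sf se (free_sep ff nmin).
move=> -[i _ iX] [j _ <-] Yf.
have ij : i <> j by move=> ij; apply: nXf; rewrite -iX ij.
have ji : j <> i by move=> ji; apply: ij.
have abs (k l : 'I_(num_loops A p)) (s : 'I_(num_exits l)) : k <> l ->
    E (beta s) * (E (beta s))^* * E (alpha k) =
    E (alpha k) * E (beta s) * (E (beta s))^* /\
    E (alpha k) * (E (alpha k))^* * E (beta s) = E (beta s).
  move=> kl; apply: (@exit_proj_loop (unbump l k)); rewrite -?sec_piS -!sec_piM.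
    exact/sec_rel/alpha_beta.
  exact/sec_rel/alpha_star_beta.
case: Yf nXf => [-> _|[s _ <-] _]; last first.
  constructor 2; exists (alpha i); first by rewrite -iX; left.
  exact: (abs _ _ _ ij).2.
constructor 3; split; first exact: (loopP j).2.
move=> y; rewrite -iX => -[->|[s _ <-]]; last exact: (abs _ _ _ ji).1.
have aa : E (alpha i) * E (alpha j) = E (alpha j) * E (alpha i).
  by rewrite -!sec_piM; exact/sec_rel/alpha_alpha.
have sa : (E (alpha i))^* * E (alpha j) = E (alpha j) * (E (alpha i))^*.
  by rewrite -sec_piS -!sec_piM; exact/esym/sec_rel/alpha_alpha_star.
by rewrite -mulgA sa mulgA aa.
Qed.

(** * The projections g g^* of paths g from a fixed vertex *)

(** The path is built from its first edge, so that induction removes the edge that meets a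
    conjugating generator. Zero belongs to every vertex because orthogonal edges produce it. *)
Inductive path_proj : vertex G -> SEC A -> Prop :=
| path_proj0 v : path_proj v 0
| path_projV v : path_proj v (V v)
| path_projE e p : path_proj (rng e) p ->
    path_proj (src e) (E e * p * (E e)^*).

Lemma path_proj_Vl v p : path_proj v p -> V v * p = p.
Proof.
by case=> [w|w|e q _]; rewrite ?smul_zero ?VV // !mulgA VE.
Qed.

Lemma path_proj_star v p : path_proj v p -> p^* = p.
Proof.
elim=> [w|w|e q _ IH]; rewrite ?sstar0 ?Vstar //.
by rewrite !sstarM sstarK IH mulgA.
Qed.

Lemma path_proj_Vr v p : path_proj v p -> p * V v = p.
Proof.
move=> vp; rewrite -[LHS]sstarK sstarM Vstar (path_proj_star vp).
by rewrite path_proj_Vl // (path_proj_star vp).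
Qed.

Lemma path_proj_idem v p : path_proj v p -> p * p = p.
Proof.
elim=> [w|w|e q vq IH]; rewrite ?smul_zero ?VV //.
rewrite !mulgA (mulgE21 _ (EsE e)) (mulgE21 _ (path_proj_Vr vq)).
by rewrite (mulgE21 _ IH).
Qed.

Lemma path_proj_edge e : path_proj (src e) (E e * (E e)^*).
Proof. by rewrite -{1}(EV e); apply: path_projE; exact: path_projV. Qed.

(** The index shifts made along the path are undone along its adjoint. *)
Lemma path_proj_T v p : path_proj v p -> forall i b, T i b v * p = p * T i b v.
Proof.
elim=> [w|w|e q _ IH] i b; first by rewrite smul_zero szero_mul.
  by rewrite VT TV.
have [j ej] := T_edge i e.
have sj : (E e)^* * T i b (src e) = T j b (rng e) * (E e)^*.
  by rewrite -[b]negbK -(Tstar i (~~ b)) -(Tstar j (~~ b)) -!sstarM ej.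
by rewrite !mulgA ej (mulgE22 _ (IH j b)) (mulgE22 _ sj).
Qed.

Lemma path_proj_TTN v p i b : path_proj v p -> T i b v * p * T i (~~ b) v = p.
Proof.
by move=> vp; rewrite (path_proj_T vp) -mulgA TTN (path_proj_Vr vp).
Qed.

(** Compare [e] with the first edge [f] of the path. Equal edges cancel and orthogonal ones give
    zero; two loops pass each other and induction applies. A loop [e] meeting an exit [f] becomes a
    unitary, which cancels against its adjoint; a loop [f] meeting an exit [e] disappears in the
    same way. *)
Lemma path_proj_conjs v p e : path_proj v p -> src e = v ->
  path_proj (rng e) ((E e)^* * p * E e).
Proof.
move=> vp; elim: vp e => [w|w|f q vq IH] e sev.
- by rewrite smul_zero szero_mul; exact: path_proj0.
- by rewrite -sev EsV EsE; exact: path_projV.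
rewrite !mulgA.
case: (edge_relP sev) => [->|ef0|re rf ef esf|i re ef esf|i rf fe fse].
- rewrite EsE (path_proj_Vl vq) (mulgE21 _ (EsE f)) (path_proj_Vr vq).
  exact: vq.
- by rewrite ef0 !szero_mul; exact: path_proj0.
- have fse : (E f)^* * E e = E e * (E f)^*.
    by rewrite -[E e]sstarK -!sstarM esf.
  rewrite esf (mulgE22 _ fse).
  have -> : E f * (E e)^* * q * E e = E f * ((E e)^* * q * E e).
    by rewrite !mulgA.
  rewrite re sev; apply: path_projE; have := IH e; rewrite re rf sev.
  exact.
- have fse : (E f)^* * E e = T i true (rng f) * (E f)^*.
    by rewrite -[E e]sstarK -sstarM esf sstarM Tstar.
  rewrite esf (mulgE22 _ fse) -(mulgA (E f)) -(mulgA (E f)).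
  by rewrite (path_proj_TTN i false vq) re sev; exact: path_projE.
- have esf : (E e)^* * E f = T i true (rng e) * (E e)^*.
    by rewrite -[E f]sstarK -sstarM fse sstarM Tstar.
  rewrite esf (mulgE22 _ fse).
  have vq' : path_proj (rng e) ((E e)^* * q * E e) by apply: IH; rewrite rf.
  by have := path_proj_TTN i true vq'; rewrite !mulgA => ->.
Qed.

(** Self-adjoint elements commute once their product is self-adjoint, so it suffices that the
    product is again a path projection. *)
Lemma path_proj_edgeC v p : path_proj v p -> forall e, src e = v ->
  E e * (E e)^* * p = p * (E e * (E e)^*).
Proof.
move=> vp e sev; suff h : path_proj v (E e * (E e)^* * p).
  have := path_proj_star h; rewrite sstarM (path_proj_star vp).
  by rewrite sstarM sstarK => <-.
elim: vp e sev => [w|w|f q vq IH] e sev.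
- by rewrite smul_zero; exact: path_proj0.
- by rewrite -sev -mulgA EsV; exact: path_proj_edge.
rewrite !mulgA.
case: (edge_relP sev) => [->|ef0|re rf ef esf|i re ef esf|i rf fe fse].
- by rewrite EEsE; exact: path_projE.
- by rewrite -(mulgA (E e)) ef0 smul_zero !szero_mul; exact: path_proj0.
- rewrite -(mulgA (E e)) esf mulgA ef.
  have -> : E f * E e * (E e)^* * q = E f * (E e * (E e)^* * q).
    by rewrite !mulgA.
  by apply: path_projE; apply: IH; rewrite rf.
- by rewrite (exit_proj_loop ef esf).2; exact: path_projE.
- rewrite (exit_proj_loop fe fse).1.
  have -> : E f * E e * (E e)^* * q = E f * (E e * (E e)^* * q).
    by rewrite !mulgA.
  by apply: path_projE; apply: IH; rewrite rf.
Qed.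

Lemma path_projC v p : path_proj v p ->
  forall q, path_proj v q -> p * q = q * p.
Proof.
elim=> [w|w|e p' vp' IH] q vq; first by rewrite smul_zero szero_mul.
  by rewrite (path_proj_Vl vq) (path_proj_Vr vq).
have eeq := path_proj_edgeC vq (erefl (src e)).
have vq' := path_proj_conjs vq (erefl (src e)).
(* Conjugating [q] by [e] moves the commutation to the range of [e], where the induction hypothesis
   for [p'] applies. *)
have L : E e * p' * (E e)^* * q = E e * (p' * ((E e)^* * q * E e)) * (E e)^*.
  by rewrite -{1}(EsV e) !mulgA -(mulgA _ (V _)) (path_proj_Vl vq) -!mulgA
    -eeq !mulgA (mulgE21 _ (EsE e)) -(mulgA _ (V _)) VEs.
rewrite L (IH _ vq') !mulgA eeq -!mulgA; congr (q * _).
by rewrite !mulgA EEsE.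
Qed.

Lemma path_proj_orth v w p q : path_proj v p -> path_proj w q -> v <> w ->
  p * q = 0.
Proof.
move=> vp wq vw; rewrite -(path_proj_Vr vp) -(path_proj_Vl wq) mulgA.
by rewrite (mulgE21 _ (VV0 vw)) smul_zero szero_mul.
Qed.

(** * Regularity of S(E,C) and identification of its idempotents *)

Definition proj (p : SEC A) : Prop := p = 0 \/ exists v, path_proj v p.

Lemma proj_star p : proj p -> p^* = p.
Proof. by case=> [->|[v /path_proj_star]]; rewrite ?sstar0. Qed.

Lemma proj_idem p : proj p -> p * p = p.
Proof. by case=> [->|[v /path_proj_idem]]; rewrite ?smul_zero. Qed.

Lemma projC p q : proj p -> proj q -> p * q = q * p.
Proof.
case=> [->|[v vp]]; first by rewrite szero_mul smul_zero.
case=> [->|[w wq]]; first by rewrite szero_mul smul_zero.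
have [vw|vw] := pselect (v = w); first by apply: path_projC vp _ _; rewrite vw.
by rewrite (path_proj_orth vp wq vw) (path_proj_orth wq vp) // => /esym.
Qed.

Lemma proj_V v : proj (V v).
Proof. by right; exists v; exact: path_projV. Qed.

Lemma proj_V_conj v p : proj p -> proj (V v * p * V v).
Proof.
case=> [->|[w wp]]; first by left; rewrite smul_zero szero_mul.
have [->|vw] := pselect (v = w).
  by right; exists w; rewrite (path_proj_Vl wp) (path_proj_Vr wp).
by left; rewrite (path_proj_orth (path_projV v) wp vw) szero_mul.
Qed.

Lemma proj_T_conj i b v p : proj p -> proj (T i b v * p * T i (~~ b) v).
Proof.
case=> [->|[w wp]]; first by left; rewrite smul_zero szero_mul.
have [vw|vw] := pselect (v = w).
  by rewrite vw path_proj_TTN //; right; exists w.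
left; rewrite -(TV i b) -(mulgA _ (V v)).
by rewrite (path_proj_orth (path_projV v) wp vw) smul_zero szero_mul.
Qed.

Lemma proj_conj s p : proj p ->
  proj (sec_pi A s * p * (sec_pi A s)^*) /\
  proj ((sec_pi A s)^* * p * sec_pi A s).
Proof.
elim: s p => [v|e|i b v||s IHs t IHt|s IH] p pp.
- by rewrite Vstar; split; exact: proj_V_conj.
- case: pp => [->|[w wp]].
    by rewrite !smul_zero !szero_mul; split; left.
  split; rewrite -/(E e).
    have [ew|ew] := pselect (rng e = w).
      by right; exists (src e); apply: path_projE; rewrite ew.
    left; rewrite -(EV e) -(mulgA _ (V _)).
    by rewrite (path_proj_orth (path_projV _) wp ew) smul_zero szero_mul.
  have [ew|ew] := pselect (src e = w).
    by right; exists (rng e); exact: path_proj_conjs wp ew.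
  left; rewrite -(EsV e) -(mulgA _ (V _)).
  by rewrite (path_proj_orth (path_projV _) wp ew) smul_zero szero_mul.
- rewrite -/(T i b v) Tstar; split; first exact: proj_T_conj.
  by have := proj_T_conj i (~~ b) v pp; rewrite negbK.
- by rewrite -/(sec_zero A) !szero_mul; split; left; rewrite ?smul_zero.
- rewrite sec_piM sstarM !mulgA.
  have [/IHs[+ _] _] := IHt _ pp; rewrite !mulgA => h; split=> //.
  by have [_ /IHt[_]] := IHs _ pp; rewrite !mulgA.
- by rewrite sec_piS sstarK; have [] := IH _ pp.
Qed.

Lemma proj_mul_star s :
  proj (sec_pi A s * (sec_pi A s)^*) /\ proj ((sec_pi A s)^* * sec_pi A s).
Proof.
elim: s => [v|e|i b v||s IHs t IHt|s IH].
- by rewrite Vstar VV; split; exact: proj_V.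
- split; first by right; exists (src e); exact: path_proj_edge.
  by rewrite EsE; exact: proj_V.
- by rewrite -/(T i b v) Tstar TTN NTT; split; exact: proj_V.
- by rewrite -/(sec_zero A) szero_mul smul_zero; split; left.
- rewrite sec_piM sstarM !mulgA.
  have [+ _] := proj_conj s IHt.1; rewrite !mulgA => h; split=> //.
  by have [_] := proj_conj t IHs.2; rewrite !mulgA.
- by rewrite sec_piS sstarK; case: IH.
Qed.

Lemma sec_regular s :
  sec_pi A s * (sec_pi A s)^* * sec_pi A s = sec_pi A s.
Proof.
elim: s => [v|e|i b v||s IHs t IHt|s IH].
- by rewrite Vstar !VV.
- exact: EEsE.
- by rewrite -/(T i b v) Tstar TTN VT.
- by rewrite -/(sec_zero A) smul_zero.
(* For a product, s^* s and t t^* are commuting projections; exchanging them separates the two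
   regularity identities. *)
- have C := projC (proj_mul_star s).2 (proj_mul_star t).1.
  rewrite sec_piM sstarM -[in RHS]IHs -[in RHS]IHt.
  have -> : sec_pi A s * sec_pi A t * ((sec_pi A t)^* * (sec_pi A s)^*) *
      (sec_pi A s * sec_pi A t) = sec_pi A s *
      (sec_pi A t * (sec_pi A t)^* * ((sec_pi A s)^* * sec_pi A s)) *
      sec_pi A t by rewrite !mulgA.
  by rewrite -C !mulgA.
- by rewrite sec_piS sstarK -[in RHS]IH !sstarM sstarK mulgA.
Qed.

Lemma idempotentsE : @idempotents (SEC A) = proj.
Proof.
apply/seteqP; split=> [e ee|p]; last exact: proj_idem.
have := proj_mul_star (repr e); have := sec_regular (repr e).
rewrite sec_reprK => eee [p1 p2].
suff es : e^* = e by move: p1; rewrite es ee.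
(* This writes [e^*] as a product of two commuting projections, so it is self-adjoint and equals
   [e]; then [e = e * e^*] is a projection. *)
have e1 : e^* = e^* * e * (e * e^*).
  have ess : e^* * e * e^* = e^* by rewrite -[in RHS]eee !sstarM sstarK mulgA.
  by rewrite mulgA -(mulgA _ e e) ee ess.
rewrite -[RHS]sstarK e1 sstarM (proj_star p1) (proj_star p2).
exact: projC.
Qed.

Lemma idempotentsC (e f : SEC A) : idempotents e -> idempotents f ->
  e * f = f * e.
Proof. by rewrite idempotentsE; exact: projC. Qed.

(** * Finite covers of a vertex, and maximality of tight filters *)

Lemma joined_zero D u v : joined D u v -> V u = 0 -> V v = 0.
Proof.
move=> [es]; elim: es u => [|e es IH] u /= => [->//|[_ <- /IH h] se0].
by apply: h; rewrite -EsE -(VE e) se0 szero_mul smul_zero.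
Qed.

(** Induction on the path. If [g] is the vertex, some edge of [X] has a vanishing range from which a
    path returns to the vertex. Otherwise the first edge [f] lies in [X], or lies below the
    projection of an edge of [X], and then [g] is fixed by a projection that kills it; or [f] is a
    loop commuting with these projections, and the hypothesis passes to the rest of the path. *)
Lemma sep_cover v g : path_proj v g -> forall X, sep v X ->
  (forall y, X y -> g * (E y * (E y)^*) = 0) -> g = 0.
Proof.
elim=> [//|w|f q vq IH] X sX gX.
  have [y Xy] := sep_joined sX; move/joined_zero; apply.
  have := gX y Xy; rewrite -(sep_src sX Xy) mulgA VE => y0.
  by rewrite -EsE -(EEsE y) y0 szero_mul smul_zero.
have vg := path_projE vq.
case: (sep_edge_cases sX erefl) => [Xf|[y Xy yf]|[rf Xf]].
- by rewrite -(gX _ Xf) !mulgA (mulgE21 _ (EsE f)) (mulgE21 _ (VEs f)).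
- have sy := sep_src sX Xy.
  rewrite -(gX _ Xy) -(path_proj_edgeC vg sy).
  by rewrite !mulgA yf.
- have -> : q = 0; last by rewrite smul_zero szero_mul.
  apply: (IH X); first by rewrite rf.
  move=> y Xy; have sy := sep_src sX Xy.
  have vq' : path_proj (src f) q by rewrite -rf.
  have := gX _ Xy; rewrite -(path_proj_edgeC vg sy) -(path_proj_edgeC vq' sy).
  rewrite !mulgA Xf // => /(congr1 (fun x => (E f)^* * x * E f)).
  rewrite /= smul_zero szero_mul !mulgA EsE (mulgE21 _ (EsE f)) rf -{1}sy VE.
  by rewrite (mulgE21 _ (path_proj_Vr vq')).
Qed.

(** [Z] is a finite substitute for the complement of [f] under the vertex: it collects the paths
    that follow [f] for a while and then leave it by another edge of the same block. *)
Lemma trapping v f : path_proj v f -> exists Z : set (SEC A),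
  [/\ finite_set Z, forall z, Z z -> path_proj v z /\ z * f = 0 &
      forall g, path_proj v g -> g * f = 0 ->
        (forall z, Z z -> g * z = 0) -> g = 0].
Proof.
elim=> [w|w|x q vq [Z [finZ Zq Zcov]]].
- exists [set V w]; split; first exact: finite_set1.
    by move=> _ ->; rewrite smul_zero; split=> //; exact: path_projV.
  by move=> g vg _ /(_ _ erefl); rewrite (path_proj_Vr vg).
- exists set0; split=> // g vg; by rewrite (path_proj_Vr vg).
have [X sX Xx] := sep_edge x.
exists ((fun z => E x * z * (E x)^*) @` Z `|`
        (fun y => E y * (E y)^*) @` (X `\ x)); split.
- rewrite finite_setU; split; apply: finite_image => //.
  by apply: finite_setD; exact: adaptable_fin_sep A _ _ sX.
- move=> _ [[z /Zq[vz zq] <-]|[y [Xy yx] <-]].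
    split; first exact: path_projE.
    rewrite !mulgA (mulgE21 _ (EsE x)) (mulgE21 _ (path_proj_Vr vz)).
    by rewrite (mulgE21 _ zq) smul_zero szero_mul.
  split; first by rewrite -(sep_src sX Xy); exact: path_proj_edge.
  by rewrite !mulgA (mulgE21 _ (EsE0 sX Xy Xx yx)) smul_zero !szero_mul.
move=> g vg gf gZ.
(* Orthogonality to a projection that starts with [x] becomes orthogonality at the range of [x]
   after conjugation, where the cover of the shorter path is available. *)
have cut z : path_proj (rng x) z -> g * (E x * z * (E x)^*) = 0 ->
    (E x)^* * g * E x * z = 0.
  move=> vz /(congr1 (fun y => (E x)^* * y * E x)).
  rewrite smul_zero szero_mul !mulgA (mulgE21 _ (EsE x)).
  by rewrite (mulgE21 _ (path_proj_Vr vz)).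
have xgx0 : (E x)^* * g * E x = 0.
  apply: Zcov.
  - exact: path_proj_conjs vg erefl.
  - exact: cut.
  - by move=> z Zz; apply: cut (Zq z Zz).1 _; apply: gZ; left; exists z.
apply: (sep_cover vg sX) => y Xy.
have [->|yx] := pselect (y = x); last by apply: gZ; right; exists y.
have vx := path_proj_edge x.
have xx := path_proj_idem vx.
rewrite -xx mulgA -(path_proj_edgeC vg erefl).
have -> : E x * (E x)^* * g * (E x * (E x)^*) =
  E x * ((E x)^* * g * E x) * (E x)^*.
  by rewrite !mulgA.
by rewrite xgx0 smul_zero szero_mul.
Qed.

Lemma tight_ultrafilter : tight_filters (SEC A) `<=` ultrafilters (SEC A).
Proof.
move=> eta eta_tight xi eta_xi.
have xiI f : sfilter_set xi f -> proj f.
  by move/(sfilter_idem (sfilterP xi)); rewrite idempotentsE.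
have nz (f : SEC A) : sfilter_set xi f -> f <> 0.
  by move=> xf f0; apply: (sfilter_no0 (sfilterP xi)); rewrite -f0.
have [e eta_e] := sfilter_neq0 (sfilterP eta).
have [e0|[v ve]] := xiI _ (eta_xi _ eta_e).
  by case: (nz _ (eta_xi _ eta_e)).
have idV : idempotents (V v) by exact: VV.
have eta_v : sfilter_set eta (V v).
  by apply: (sfilter_up (sfilterP eta) eta_e) => //; exact: path_proj_Vr.
suff xi_eta : xi `<=` eta.
  have : sfilter_set xi = sfilter_set eta by apply/seteqP.
  move: (xi) (eta) => [s sP] [t tP] /= st; rewrite {}st in sP *.
  by congr SFilter; exact: Prop_irrelevance.
move=> f xi_f; have [f0|[w wf]] := xiI _ xi_f; first by case: (nz _ xi_f).
(* Projections at different vertices are orthogonal, and [xi] contains both [V v] and [f]. *)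
have vw : v = w.
  apply: contrapT => vw; apply: (nz (V v * f)).
    by apply: (sfilter_mul (sfilterP xi)) => //; exact: eta_xi.
  exact: path_proj_orth (path_projV v) wf vw.
rewrite -{}vw in wf; have [Z [finZ Zf Zcov]] := trapping wf.
have belowV z : path_proj v z -> below (V v) z.
  by move=> vz; split; [exact: path_proj_idem vz|exact: path_proj_Vr].
have cov : finite_cover (V v) (f |` Z).
  split; first by rewrite finite_setU.
    by move=> z [->|/Zf[vz _]]; exact: belowV.
  move=> g [ig gv] g0; apply: contrapT => nocov; apply: g0.
  have gz z : (f |` Z) z -> g * z = 0.
    by move=> Zz; apply: contrapT => ?; apply: nocov; exists z.
  have vg : path_proj v g.
    move: ig; rewrite idempotentsE => -[->|[u ug]]; first exact: path_proj0.
    have [<-//|uv] := pselect (u = v).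
    rewrite -gv (path_proj_orth ug (path_projV v) uv); exact: path_proj0.
  by apply: Zcov vg _ _ => [|z Zz]; apply: gz; [left|right].
(* Tightness puts [f] or some [z] in [Z] into [eta]; the latter would put [z * f], which is zero,
   into [xi]. *)
have [z [[->//|Zz] eta_z]] := eta_tight _ _ idV cov eta_v.
case: (nz (z * f)); last exact: (Zf z Zz).2.
by apply: (sfilter_mul (sfilterP xi)) => //; exact: eta_xi.
Qed.

End Generators.

Theorem theorem3p6 (G : sepgraph) (A : adaptable G) :
  closed (ultrafilters (SEC A)) /\
  ultrafilters (SEC A) = tight_filters (SEC A).
Proof.
have eq_ut : ultrafilters (SEC A) = tight_filters (SEC A).
  apply/seteqP; split; last exact: tight_ultrafilter.
  exact/ultrafilter_tight/idempotentsC.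
by rewrite eq_ut; split=> //; exact: closed_tight_filters.
Qed.
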